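(* Let $X$ and $Y$ be function spaces in the wide sense on $(\Omega,\Sigma,\mu,\Delta_X)$ and $(\Omega,\Sigma,\mu,\Delta_Y)$ respectively, and let $T:X\to Y$ be a compact operator such that $T(\Delta_X)=\Delta_Y$, i.e. $T(\Delta_X(A,f))=\Delta_Y(A,T(f))$ for all $A\in\Sigma$, $f\in X$. Suppose that $T$ is pointwise weakly absolutely continuous. Then $T$ is absolutely continuous.
   Context: All Banach spaces are complex; $(\Omega,\Sigma,\mu)$ is a measure space. A Banach space $Y$ is a function space in the wide sense on $(\Omega,\Sigma,\mu,\Delta_Y)$ if $\Delta_Y:\Sigma\times Y\to Y$ satisfies: (I) $\Delta_Y(A\cap B,f)=\Delta_Y(A,\Delta_Y(B,f))$ for all $A,B\in\Sigma$, $f\in Y$; (II) $f\mapsto\Delta_Y(A,f)$ is linear for each $A\in\Sigma$; (III) $\Delta_Y(A\cup B,f)=\Delta_Y(A,f)+\Delta_Y(B,f)$ if $A\cap B=\emptyset$; (IV) $\Delta_Y(A,f)=0$ if $\mu(A)=0$, and $\Delta_Y(\Omega,f)=f$; (V) there is $C>0$ with $\|\Delta_Y(A,f)\|\le C\|f\|$ for all $A,f$. A bounded operator $T:X\to Y$ is absolutely continuous if for every $\varepsilon>0$ there is $\delta>0$ such that for every $A\in\Sigma$ with $\mu(A)<\delta$, the operator $f\mapsto T(\Delta_X(A,f))$ has norm $<\varepsilon$ in $\mathcal L(X,Y)$. $T$ is pointwise weakly absolutely continuous if for every $f\in X$, $y^*\in Y^*$ and $\varepsilon>0$ there is $\delta>0$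 such that $|\langle T(\Delta_X(A,f)),y^*\rangle|<\varepsilon$ whenever $A\in\Sigma$ and $\mu(A)<\delta$. *)

(* Defs.v *)
From HB Require Import structures.
From mathcomp Require Import all_boot all_order all_algebra.
From mathcomp Require Import complex.
From mathcomp Require Import all_classical all_reals all_analysis.

Set Implicit Arguments.
Unset Strict Implicit.
Unset Printing Implicit Defensive.

Import Order.TTheory GRing.Theory Num.Theory.
Import numFieldNormedType.Exports.

Local Open Scope classical_set_scope.
Local Open Scope ring_scope.
Local Open Scope complex_scope.

Section wide_function_spaces.
Context {R : realType} {d : measure_display} {Omega : measurableType d}.
Variable mu : {measure set Omega -> \bar R}.

(* [Delta A f] is only meaningful for measurable [A]: on other sets its value is
   an unconstrained default. *)
Record wide_function_space (Y : completeNormedModType R[i])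
    (Delta : set Omega -> Y -> Y) : Prop := WideFunctionSpace {
  wfs_setI : forall (A B : set Omega) (f : Y), measurable A -> measurable B ->
    Delta (A `&` B) f = Delta A (Delta B f) ;
  wfs_linear : forall A : set Omega, measurable A -> linear (Delta A) ;
  wfs_setU : forall (A B : set Omega) (f : Y), measurable A -> measurable B ->
    A `&` B = set0 -> Delta (A `|` B) f = Delta A f + Delta B f ;
  wfs_null : forall (A : set Omega) (f : Y), measurable A ->
    mu A = 0%E -> Delta A f = 0 ;
  wfs_setT : forall f : Y, Delta setT f = f ;
  wfs_bounded : exists2 C : R, 0 < C &
    forall (A : set Omega) (f : Y), measurable A ->
      `|Delta A f| <= C%:C * `|f| }.

(* The norm of a module over R[i] takes its values in R[i]; these are
   nonnegative reals, hence the projection [complex.Re]. The supremum is taken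
   in the extended reals, so that it is +oo when S is unbounded. *)
Definition operator_norm (X Y : normedModType R[i]) (S : X -> Y) : \bar R :=
  ereal_sup [set (complex.Re `|S x|)%:E | x in [set x : X | `|x| <= 1]].

Definition compact_operator (X Y : completeNormedModType R[i])
    (T : {linear X -> Y}) : Prop :=
  precompact (T @` [set x : X | `|x| <= 1]).

(* [continuous T] records that absolute continuity is a property of bounded
   operators. *)
Definition absolutely_continuous_operator (X Y : completeNormedModType R[i])
    (DeltaX : set Omega -> X -> X) (T : {linear X -> Y}) : Prop :=
  continuous T /\
  forall e : R, 0 < e -> exists2 delta : R, 0 < delta &
    forall A : set Omega, measurable A -> (mu A < delta%:E)%E ->
      (operator_norm (fun f : X => T (DeltaX A f)) < e%:E)%E.

Definition pointwise_weakly_absolutely_continuous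
    (X Y : completeNormedModType R[i])
    (DeltaX : set Omega -> X -> X) (T : {linear X -> Y}) : Prop :=
  forall (f : X) (phi : {linear Y -> R[i]^o}), continuous phi ->
    forall e : R, 0 < e -> exists2 delta : R, 0 < delta &
      forall A : set Omega, measurable A -> (mu A < delta%:E)%E ->
        `|phi (T (DeltaX A f))| < e%:C.

End wide_function_spaces.

(* Main.v *)
From HB Require Import structures.
Require Import Defs.
From mathcomp Require Import all_boot all_order all_algebra.
From mathcomp Require Import complex ring lra.
From mathcomp Require Import all_classical all_reals all_analysis.

Import Order.TTheory GRing.Theory Num.Theory.
Import numFieldNormedType.Exports.

(** The heart of the matter is that a net [u] which stays in a compact set and
    tends weakly to [0] tends to [0] in norm: a nonzero cluster point would be
    detected by a continuous functional (Hahn-Banach). Applied to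
    [A |-> T (Delta_X A f)] as [mu A] tends to [0], whose values lie in a
    multiple of the precompact set [T (unit ball)], it upgrades weak to norm
    convergence for each [f]. As [T (Delta_X A f) = Delta_Y A (T f)] and the
    operators [Delta_Y A] are equi-Lipschitz, the convergence is then uniform on
    the precompact set [T (unit ball)].

    Hahn-Banach is obtained from minimal sublinear functionals, which are
    linear; the complex functional is [f x - i f (i x)] with [f] real-linear. *)

Local Open Scope classical_set_scope.
Local Open Scope ring_scope.
Local Open Scope complex_scope.

(** * Sublinear functionals and the real Hahn-Banach theorem *)

Section sublinear_functionals.
Context {R : realType} {V : lmodType R}.
Implicit Types (q p g : V -> R) (v x y : V).

Definition sublinear q :=
  (forall x y, q (x + y) <= q x + q y) /\
  (forall a x, 0 < a -> q (a *: x) <= a * q x).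

Lemma sublinear0 q : sublinear q -> q 0 = 0.
Proof.
move=> [qD qZ]; have := qD 0 0; have := qZ 2^-1 0 ltac:(by rewrite invr_gt0).
by rewrite scaler0 addr0; lra.
Qed.

Lemma sublinearZ q a x : sublinear q -> 0 <= a -> q (a *: x) = a * q x.
Proof.
move=> sq; rewrite le_eqVlt => /predU1P[<-|a0].
  by rewrite scale0r mul0r sublinear0.
apply/eqP; rewrite eq_le sq.2//= -ler_pdivlMl//.
by rewrite -[X in q X <= _](scalerK (lt0r_neq0 a0)) sq.2// invr_gt0.
Qed.

Lemma sublinear_geN q x : sublinear q -> - q (- x) <= q x.
Proof.
by move=> sq; have := sq.1 x (- x); rewrite subrr sublinear0//; lra.
Qed.

(** Members of [G] need not be sublinear: sums and positive multiples of their values only have to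
    dominate values of some member. This serves both [directional] and infima of chains. *)
Lemma inf_sublinear (G : set (V -> R)) : G !=set0 ->
  (forall x, has_lbound [set g x | g in G]) ->
  (forall g h x y, G g -> G h -> exists2 k, G k & k (x + y) <= g x + h y) ->
  (forall g a x, G g -> 0 < a -> exists2 k, G k & k (a *: x) <= a * g x) ->
  sublinear (fun x => inf [set g x | g in G]).
Proof.
move=> G0 Glb GD GZ.
have n0 x : [set g x | g in G] !=set0 by case: G0 => g Gg; exists (g x), g.
have le_G g x : G g -> inf [set g x | g in G] <= g x.
  by move=> Gg; apply: ge_inf => //; exists g.
split=> [x y|a x a0].
  rewrite -lerBlDr; apply: lb_le_inf => // _ [g Gg <-].
  rewrite lerBlDr -lerBlDl; apply: lb_le_inf => // _ [h Gh <-].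
  rewrite lerBlDl; have [k Gk] := GD g h x y Gg Gh.
  by apply: le_trans; exact: le_G.
rewrite -ler_pdivrMl//; apply: lb_le_inf => // _ [g Gg <-].
rewrite ler_pdivrMl//; have [k Gk] := GZ g a x Gg a0.
by apply: le_trans; exact: le_G.
Qed.

(* The largest sublinear functional below [q] which takes the value [- q v] at
   [- v]. It is below [q], so a minimal [q] satisfies [q x <= q (x + v) - q v];
   started from [p], it forces every functional below it to equal [p] at [v]. *)
Definition directional q v x :=
  inf [set g x | g in
    [set (fun x => q (x + t *: v) - t * q v) | t in [set t : R | 0 <= t]]].

Section directional.
Variables (q : V -> R) (v : V).
Hypothesis sq : sublinear q.

Let G : set (V -> R) :=
  [set (fun x => q (x + t *: v) - t * q v) | t in [set t : R | 0 <= t]].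

Let G_lbound x : has_lbound [set g x | g in G].
Proof.
(* Subadditivity for [t *: v = - x + (x + t *: v)] gives a bound free of [t]. *)
exists (- q (- x)) => _ [_ [t /= t0 <-] <-].
rewrite -(sublinearZ q t v)//; have := sq.1 (- x) (x + t *: v).
by rewrite addKr; lra.
Qed.

Lemma directional_sublinear : sublinear (directional q v).
Proof.
apply: inf_sublinear; [|exact: G_lbound| |].
- by exists (fun x => q (x + 0 *: v) - 0 * q v), 0 => /=.
- move=> _ _ x y [s /= s0 <-] [t /= t0 <-].
  exists (fun x => q (x + (s + t) *: v) - (s + t) * q v).
    by exists (s + t) => //=; exact: addr_ge0.
  have := sq.1 (x + s *: v) (y + t *: v).
  by rewrite scalerDl addrACA mulrDl; lra.
- move=> _ a x [t /= t0 <-] a0.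
  exists (fun x => q (x + (a * t) *: v) - (a * t) * q v).
    by exists (a * t) => //=; rewrite mulr_ge0// ltW.
  have := sq.2 a (x + t *: v) a0.
  by rewrite scalerDr scalerA mulrBr mulrA; lra.
Qed.

Lemma directional_le t x : 0 <= t ->
  directional q v x <= q (x + t *: v) - t * q v.
Proof.
move=> t0; apply: ge_inf => //.
by exists (fun x => q (x + t *: v) - t * q v) => //; exists t.
Qed.

Lemma directional_le_id x : directional q v x <= q x.
Proof.
by have := directional_le 0 x (lexx _); rewrite scale0r addr0 mul0r subr0.
Qed.

End directional.

(** Zorn's lemma: a nonempty chain is bounded by its pointwise infimum, finite because sublinear
    functionals below [p] stay above [- p (- x)] at [x]. *)
Lemma exists_minimal_sublinear p : sublinear p ->
  exists q, [/\ sublinear q, forall x, q x <= p x &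
    forall r, sublinear r -> (forall x, r x <= q x) -> forall x, q x <= r x].
Proof.
move=> sp; pose T := {q | sublinear q /\ forall x, q x <= p x}.
(* The order is reversed: maximal for [ge] means minimal as a functional. *)
pose ge (s t : T) := `[< forall x, sval t x <= sval s x >].
have [t|r s t /asboolP rs /asboolP st|A totA|[q [sq qp]] qmin] :=
    @ZL_preorder T (exist _ p (conj sp (fun x => lexx _))) ge.
- by apply/asboolP.
- by apply/asboolP => x; exact: le_trans (st x) (rs x).
- have [[t0 At0]|A0] := pselect (A !=set0); last first.
    exists (exist _ p (conj sp (fun x => lexx _))) => s As.
    by case: A0; exists s.
  pose G : set (V -> R) := [set sval s | s in A].
  have Glb x : has_lbound [set g x | g in G].
    exists (- p (- x)) => _ [_ [[q [sq qp]] _ <-] <-] /=.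
    by have := qp (- x); have := sublinear_geN q x sq; lra.
  have sG : sublinear (fun x => inf [set g x | g in G]).
    apply: inf_sublinear => //; first by exists (sval t0), t0.
    - move=> _ _ x y [s As <-] [t At <-].
      have [/asboolP st|/asboolP ts] := totA _ _ As At.
        exists (sval t); first by exists t.
        by apply: le_trans ((svalP t).1.1 x y) _; rewrite lerD2r.
      exists (sval s); first by exists s.
      by apply: le_trans ((svalP s).1.1 x y) _; rewrite lerD2l.
    - move=> _ a x [s As <-] a0; exists (sval s); first by exists s.
      exact: (svalP s).1.2.
  have le_G s x : A s -> inf [set g x | g in G] <= sval s x.
    by move=> As; apply: ge_inf => //; exists (sval s) => //; exists s.
  have Gp x : inf [set g x | g in G] <= p x.
    exact: le_trans (le_G _ x At0) ((svalP t0).2 x).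
  exists (exist _ (fun x => inf [set g x | g in G]) (conj sG Gp)) => s As.
  by apply/asboolP => x /=; exact: le_G.
exists q; split=> // r sr rq x.
have rp y : r y <= p y by exact: le_trans (rq y) (qp y).
by have /(_ _)/asboolP := qmin (exist _ r (conj sr rp)); apply; exact/asboolP.
Qed.

(** Minimality against [directional q y] at [t = 1] gives [q x + q y <= q (x + y)]. Additivity makes
    [q] odd, which settles negative scalars. *)
Lemma minimal_sublinear_scalar q : sublinear q ->
  (forall r, sublinear r -> (forall x, r x <= q x) -> forall x, q x <= r x) ->
  scalar q.
Proof.
move=> sq qmin.
have qD x y : q (x + y) = q x + q y.
  apply/eqP; rewrite eq_le sq.1/=.
  have := qmin _ (directional_sublinear q y sq) (directional_le_id q y sq) x.
  have := directional_le q y sq 1 x ler01; rewrite scale1r mul1r; lra.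
have qN x : q (- x) = - q x.
  by have := qD x (- x); rewrite subrr sublinear0//; lra.
move=> a x y; rewrite qD; congr (_ + _).
have [a0|/ltW a0] := leP 0 a; first exact: sublinearZ.
by rewrite -[a]opprK scaleNr qN sublinearZ ?oppr_ge0// [RHS]mulNr.
Qed.

Theorem Hahn_Banach_point p v : sublinear p ->
  exists f : {scalar V}, (forall x, f x <= p x) /\ f v = p v.
Proof.
move=> sp; have sd := directional_sublinear p v sp.
have [q [sq qd qmin]] := exists_minimal_sublinear _ sd.
have lq := minimal_sublinear_scalar _ sq qmin.
pose Lq := GRing.isLinear.Build _ _ _ _ q lq.
pose f : {scalar V} := HB.pack q Lq.
have fp x : f x <= p x := le_trans (qd x) (directional_le_id p v sp x).
exists f; split=> //; apply/eqP; rewrite eq_le fp/=.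
(* Here [q (- v) <= p 0 - p v = - p v], the missing half of [f v = p v]. *)
have := qd (- v); have := directional_le p v sp 1 (- v) ler01.
rewrite scale1r addNr sublinear0// mul1r sub0r -[q]/(f : V -> R) linearN /=.
lra.
Qed.

End sublinear_functionals.

(** * Restriction of scalars to [R], on a copy of the type to keep the two scalings apart *)

Definition real_restriction {R : realType} (V : lmodType R[i]) : Type := V.

Section real_restriction.
Context {R : realType} {V : lmodType R[i]}.
Local Notation W := (real_restriction V).

HB.instance Definition _ := GRing.Zmodule.on W.

Let scale (a : R) (x : W) : W := (a%:C : R[i]) *: (x : V).

Let scaleA a b x : scale a (scale b x) = scale (a * b) x.
Proof. by rewrite /scale scalerA rmorphM. Qed.

Let scale1 : left_id 1 scale.
Proof. by move=> x; rewrite /scale rmorph1 scale1r. Qed.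

Let scaleDr : right_distributive scale +%R.
Proof. by move=> a x y; rewrite /scale scalerDr. Qed.

Let scaleDl x : {morph scale^~ x : a b / a + b}.
Proof. by move=> a b; rewrite /scale rmorphD scalerDl. Qed.

HB.instance Definition _ :=
  GRing.Zmodule_isLmodule.Build R W scaleA scale1 scaleDr scaleDl.

Lemma real_restriction_scaleE (a : R) (x : W) : a *: x = a%:C *: (x : V).
Proof. by []. Qed.

End real_restriction.

(** * Complex functionals from real ones *)

Section complex_norm.
Context {R : realType} {V : normedModType R[i]}.

Lemma Re_normK (x : V) : (complex.Re `|x|)%:C = `|x|.
Proof. by rewrite RRe_real// ger0_real. Qed.

Lemma Re_norm_sublinear :
  @sublinear R (real_restriction V)
    (fun x => complex.Re `|x : V|).
Proof.
split=> [x y|a x a0].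
  by rewrite -lecR rmorphD/= !Re_normK ler_normD.
rewrite real_restriction_scaleE -lecR rmorphM/= !Re_normK normrZ.
by rewrite ger0_norm// ler0c ltW.
Qed.

(** Hahn-Banach with the norm as [p] gives a real functional whose value at [v] is the norm of [v];
    it is the real part of [phi]. *)
Lemma exists_functional_neq0 (v : V) : v != 0 ->
  exists2 phi : {linear V -> R[i]^o}, continuous phi & phi v != 0.
Proof.
move=> v0.
have [f [fp fv]] :=
  @Hahn_Banach_point R (real_restriction V) _ v Re_norm_sublinear.
pose W := real_restriction V.
have fabs (x : W) : `|f x| <= complex.Re `|x : V|.
  rewrite ler_norml fp andbT lerNl -linearN.
  by apply: le_trans (fp _) _; rewrite normrN.
have fZ (a : R) (x : W) : f (a *: x) = a * f x by rewrite linearZ.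
pose g (x : V) : R[i]^o := f (x : W) +i* (- f ('i *: x : V)).
have gl : linear g.
  move=> [a b] x y; rewrite /g.
  (* Complex combinations are rewritten as real ones, to which the real linearity of [f] applies. *)
  have e1 : (a +i* b) *: x + y = a *: (x : W) + b *: ('i *: x : W) + y :> W.
    change ((a +i* b) *: x + y = a%:C *: x + b%:C *: ('i *: x) + y :> V).
    by rewrite scalerA -scalerDl; congr (_ *: _ + _); simpc.
  have e2 : 'i *: ((a +i* b) *: x + y) =
      a *: ('i *: x : W) - b *: (x : W) + ('i *: y : W) :> W.
    change ('i *: ((a +i* b) *: x + y) =
      a%:C *: ('i *: x) - b%:C *: x + 'i *: y :> V).
    rewrite scalerDr !scalerA -scaleNr -scalerDl.
    by congr (_ *: _ + _); simpc.
  rewrite e2 e1 !linearD [f (- _)]linearN !fZ.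
  by apply/eqP; rewrite eq_complex /=; apply/andP; split; apply/eqP; ring.
pose phi : {linear V -> R[i]^o} :=
  HB.pack g (GRing.isLinear.Build _ _ _ _ g gl).
exists phi; last first.
  apply/eqP => /(congr1 (@complex.Re R)) /= fv0.
  by move: v0; rewrite -normr_eq0 -Re_normK -fv [f v]fv0 eqxx.
(* The real and imaginary parts of [phi x] contribute at most [r] each. *)
apply/linear_bounded_continuous/bounded_funP => r; exists (r + r) => x xr.
have -> : phi x = (f (x : W))%:C + 'i * (- f ('i *: x : V))%:C.
  by rewrite /= [LHS]complexE.
apply: le_trans (ler_normD _ _) _.
have normR (a : R) : `|a%:C| = `|a|%:C.
  by rewrite normc_def /= expr0n/= addr0 sqrtr_sqr.
apply: lerD.
  by rewrite normR (le_trans _ xr)// -Re_normK lecR fabs.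
have i1 : `|'i : R[i]| = 1 by rewrite normc_def /= expr0n expr1n add0r sqrtr1.
rewrite normrM i1 mul1r normR normrN (le_trans _ xr)// -[leRHS]Re_normK lecR.
by apply: le_trans (fabs _) _; rewrite normrZ i1 mul1r.
Qed.

End complex_norm.

(** * Uniform bounds on compact sets *)

Section compactness.
Context {K : numFieldType}.

Lemma compact_norm_le (V : normedModType K) (A : set V) : compact A ->
  exists M, forall x, A x -> `|x| <= M.
Proof.
move=> /compact_near_coveringP/(_ _ (+oo_K) (fun r x => `|x| <= r)).
move=> /(_ _ _)/pinfty_ex_gt0[|M _ AM]; last by exists M.
move=> x Ax; have nx : \forall y \near x, `|x - y| < 1.
  exact: cvgr_dist_lt (@cvg_id _ (nbhs x)) _ ltr01.
near=> y r => /=; apply: (@le_trans _ _ (`|x| + 1)); last first.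
  by near: r; apply: nbhs_pinfty_ge; rewrite realD// normr_real.
rewrite -[y](subKr x) (le_trans (ler_normB _ _))//.
by rewrite lerD2l ltW//; near: y.
Unshelve. all: by end_near. Qed.

(** Compactness concerns [A] but convergence is known only on [S], so each centre of the cover of
    [A] is traded for a nearby point of [S]. *)
Lemma equiLipschitz_cvg0_uniform {I : Type} {F : set_system I} {FF : Filter F}
    (V W : normedModType K) (A S : set V) (L : I -> V -> W) (C : K) :
  compact A -> S `<=` A -> 0 < C ->
  (\forall i \near F, forall x y, `|L i x - L i y| <= C * `|x - y|) ->
  (forall x, S x -> L i x @[i --> F] --> 0) ->
  forall e, 0 < e -> \forall i \near F, forall x, S x -> `|L i x| < e.
Proof.
move=> cA SA C0 Llip Lcvg e e0; have e20 : 0 < e / 2 by rewrite divr_gt0.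
(* Two points within [h] of [x] are at distance at most [e / 2 / C]. *)
pose h := e / 2 / C / 2; have h0 : 0 < h by rewrite !divr_gt0.
have /compact_near_coveringP := cA.
move=> /(_ _ F (fun i x => S x -> `|L i x| < e) _) cov.
suff : \near F, A `<=` (fun x => S x -> `|L F x| < e).
  by apply: filterS => i Ai x Sx; apply: Ai => //; exact: SA.
apply: cov => x Ax.
have nx : \forall y \near x, `|x - y| < h.
  exact: cvgr_dist_lt (@cvg_id _ (nbhs x)) _ h0.
(* Without a point of [S] this close, the claim near [x] is vacuous. *)
have [[z Sz xz]|noS] := pselect (exists2 z, S z & `|x - z| < h); last first.
  by near=> y i => /= Sy; case: noS; exists y => //; near: y.
have Lz : \forall i \near F, `|L i z| < e / 2.
  exact: cvgr0_norm_lt (Lcvg _ Sz) _ e20.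
near=> y i => /= _; rewrite -[L i y](subrK (L i z)) (splitr e).
apply: le_lt_trans (ler_normD _ _) _; apply: ler_ltD; last by near: i.
have /le_trans -> // : `|L i y - L i z| <= C * `|y - z|.
  by move: (y) (z); near: i.
rewrite -ler_pdivlMl// mulrC [leRHS]splitr (le_trans (ler_distD x _ _))//.
by apply: lerD; apply: ltW => //; rewrite distrC; near: y.
Unshelve. all: by end_near. Qed.

End compactness.

(** * From weak to norm convergence in compact sets *)

Section complex_compactness.
Context {R : realType}.

Lemma weakly_null_in_compact_cvg0 {I : Type} {F : set_system I}
    {FF : Filter F} (V : normedModType R[i]) (A : set V) (u : I -> V) :
  compact A -> (\forall i \near F, A (u i)) ->
  (forall phi : {linear V -> R[i]^o}, continuous phi ->
     phi (u i) @[i --> F] --> (0 : R[i]^o)) ->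
  u i @[i --> F] --> 0.
Proof.
move=> cA Au wu; apply/cvgr0Pnorm_lt => e e0.
have /compact_near_coveringP := cA.
(* The equation [u i = x] lets point and index vary independently in the covering argument; at the
   end [x] is taken to be [u i]. *)
move=> /(_ _ F (fun i x => u i = x -> `|x| < e) _) cov.
suff : \near F, A `<=` (fun x => u F = x -> `|x| < e).
  by move=> FA; near=> i; near: i; apply: filterS2 FA Au => i + Aui; exact.
apply: cov => x _; have [->|x0] := eqVneq x 0.
  near=> y i => /= _; near: y.
  exact: cvgr0_norm_lt (@cvg_id _ (nbhs (0 : V))) _ e0.
have [phi cphi phix] := exists_functional_neq0 x x0.
(* This threshold separates [phi (u i)], eventually below it in norm, from [phi y] for [y] near
   [x]. *)
have px0 : 0 < `|phi x| / 2 by rewrite divr_gt0// normr_gt0.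
have lt : `|phi x| / 2 < `|phi x| by rewrite [ltRHS]splitr ltrDl.
have Fi : \forall i \near F, `|phi (u i)| < `|phi x| / 2.
  exact: cvgr0_norm_lt (wu _ cphi) _ px0.
have Fx : \forall y \near x, `|phi x| / 2 < `|phi y|.
  exact: cvgr_norm_gt (cphi x) _ lt.
near=> y i => /= uy; exfalso.
have : `|phi (u i)| < `|phi y|.
  by apply: (@lt_trans _ _ (`|phi x| / 2)); [near: i|near: y].
by rewrite uy ltxx.
Unshelve. all: by end_near. Qed.

Lemma compact_operator_continuous (X Y : completeNormedModType R[i])
  (T : {linear X -> Y}) : compact_operator T -> continuous T.
Proof.
move=> [A TA [/compact_norm_le[M AM] _]].
apply/linear_bounded_continuous/ex_bound; exists M.
apply/nbhs_norm0P; exists 1 => //= x /= /ltW x1.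
by apply: AM; apply: TA; exists x.
Qed.

End complex_compactness.

(** * The filter of sets of small measure *)

Section small_sets.
Context {R : realType} {d : measure_display} {Omega : measurableType d}.
Variable mu : {measure set Omega -> \bar R}.

(** Limits as [mu A] tends to 0. Measurability is built in because [Delta] is unconstrained on other
    sets. *)
Definition small_sets : set_system (set Omega) :=
  filter_from [set e : R | 0 < e]
    (fun e => [set A | measurable A /\ (mu A < e%:E)%E]).

Global Instance small_sets_filter : Filter small_sets.
Proof.
apply: filter_from_filter; first by exists 1 => /=.
move=> e1 e2 /= e10 e20; exists (Num.min e1 e2) => /=.
  by rewrite lt_min e10.
by move=> A [mA]; rewrite EFin_min lt_min => /andP[].
Qed.

Lemma small_setsP (P : set Omega -> Prop) :
  (\forall A \near small_sets, P A) <->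
  exists2 delta : R, 0 < delta &
    forall A, measurable A -> (mu A < delta%:E)%E -> P A.
Proof.
split=> -[e e0 eP]; exists e => //; first by move=> A mA muA; exact: eP.
by move=> A [mA muA]; exact: eP.
Qed.

Lemma near_small_sets_measurable : \forall A \near small_sets, measurable A.
Proof. by apply/small_setsP; exists 1. Qed.

End small_sets.

(** * Absolute continuity of the compact operator *)

Theorem mainTheorem3 (R : realType) (d : measure_display)
    (Omega : measurableType d) (mu : {measure set Omega -> \bar R})
    (X Y : completeNormedModType R[i])
    (DeltaX : set Omega -> X -> X) (DeltaY : set Omega -> Y -> Y)
    (T : {linear X -> Y})
    (wfsX : wide_function_space mu DeltaX)
    (wfsY : wide_function_space mu DeltaY)
    (compactT : compact_operator T)
    (commT : forall (A : set Omega) (f : X), measurable A ->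
       T (DeltaX A f) = DeltaY A (T f))
    (pwacT : pointwise_weakly_absolutely_continuous mu DeltaX T) :
  absolutely_continuous_operator mu DeltaX T.
Proof.
split; first exact: compact_operator_continuous.
have [K TK [cK _]] := compactT.
have [CX CX0 boundX] := wfs_bounded wfsX.
have [CY CY0 boundY] := wfs_bounded wfsY.
have CX0' : 0 < CX%:C by rewrite ltcR.
have TDelta0 f : `|f| <= 1 -> T (DeltaX A f) @[A --> small_sets mu] --> 0.
  (* Dividing by [CX] brings [DeltaX A f] into the unit ball, so that [u A] stays in [K]. *)
  move=> f1; pose u A := T (CX%:C^-1 *: DeltaX A f).
  suff u0 : u A @[A --> small_sets mu] --> 0.
    rewrite -(scaler0 _ CX%:C).
    have -> : (fun A => T (DeltaX A f)) = (fun A => CX%:C *: u A).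
      apply/funext => A.
      by rewrite /u linearZ /= scalerA divff ?scale1r ?gt_eqF.
    exact: cvgZr.
  apply: (@weakly_null_in_compact_cvg0 _ _ _ _ _ K) => //.
    apply: filterS (near_small_sets_measurable mu) => A mA.
    apply: TK; exists (CX%:C^-1 *: DeltaX A f) => //=.
    rewrite normrZ ger0_norm ?invr_ge0 ?(ltW CX0')// ler_pdivrMl//.
    by rewrite (le_trans (boundX _ _ mA))// ler_pM2l.
  move=> phi cphi.
  have -> : (fun A => phi (u A)) = (fun A => CX%:C^-1 *: phi (T (DeltaX A f))).
    by apply/funext => A; rewrite /u !linearZ.
  rewrite -[X in _ --> X](scaler0 _ CX%:C^-1); apply: cvgZr.
  apply/cvgr0Pnorm_lt => e e0.
  (* A positive element of [R[i]] is real, so [pwacT] applies to its real part. *)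
  have eE : (complex.Re e)%:C = e by rewrite RRe_real// gtr0_real.
  have Re0 : 0 < complex.Re e by rewrite -ltcR eE.
  by rewrite -eE; apply/small_setsP; exact: pwacT.
move=> e e0.
(* A supremum of values below [e / 2] is at most [e / 2], hence strictly below [e]. *)
have e20 : 0 < (e / 2)%:C by rewrite ltcR divr_gt0.
have /small_setsP[delta delta0 small] : \forall A \near small_sets mu,
    forall y, [set T f | f in [set f : X | `|f| <= 1]] y ->
      `|DeltaY A y| < (e / 2)%:C.
  apply: (@equiLipschitz_cvg0_uniform _ _ _ _ _ _ K _ _ CY%:C) => //.
  - by rewrite ltcR.
  - apply: filterS (near_small_sets_measurable mu) => A mA x y.
    pose D : {linear Y -> Y} :=
      HB.pack (DeltaY A) (GRing.isLinear.Build _ _ _ _ _ (wfs_linear wfsY mA)).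
    by rewrite -[DeltaY A x]/(D x) -[DeltaY A y]/(D y) -linearB boundY.
  - move=> _ [f f1 <-]; apply: cvg_trans (TDelta0 f f1).
    apply: near_eq_cvg.
    by apply: filterS (near_small_sets_measurable mu) => A mA; rewrite commT.
exists delta => // A mA muA; apply: (@le_lt_trans _ _ (e / 2)%:E); last first.
  by rewrite lte_fin; lra.
apply: ge_ereal_sup => _ [f /= f1 <-].
rewrite lee_fin commT// -lecR Re_normK ltW//; apply: small => //.
by exists f.
Qed.
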